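(* Assume that conditions (A1)–(A5) listed in the context hold, with $p,\delta$ as in (A5), and let $z\in\mathcal{X}$. Define, for real $L\ge1$, $$W(L):=\big(L+2\,\mathbb{E}[\tau_{\pi(\theta_0),z}]\big)\,U_{1,z}(L)\,\pi(\theta_0)V\left(3+\frac{2M\rho^L}{1-\rho^L}\right).$$ If $\mathbb{E}[\tau_{\pi(\theta_0),z}]-1\ge1$, then $$\frac{W(1)}{W\big(\mathbb{E}[\tau_{\pi(\theta_0),z}]-1\big)}>\frac{\mathbb{E}[\tau_{\pi(\theta_0),z}]-1}{3}.$$
   Context: Setting. $\mathcal{X}$ is a general state space, $\Theta\subseteq\mathbb{R}$ a parameter set, and $(P(\theta):\theta\in\Theta)$ a family of Markov transition kernels $P(\theta,x,dy)$ on $\mathcal{X}$; $P(\theta)$ has a unique invariant distribution $\pi(\theta)$. $f:\mathcal{X}\to\mathbb{R}$ is integrable under $\pi(\theta)$. $\theta_0\in\Theta$ is fixed. $\mathbb{E}^{\theta}_x$ denotes expectation for the chain $(X_i)_{i\ge0}$ with kernel $P(\theta)$ and $X_0=x$. $Ph(x):=\int h(y)P(x,dy)$, $\mu h:=\int h\,d\mu$, and $|h|_V:=\sup_{x}|h(x)|/V(x)$. Coupling. $\bar P(\theta)$ is a kernel on $\mathcal{X}\times\mathcal{X}$ with marginals $\bar P(\theta,(x,y),\mathcal{A}\times\mathcal{X})=P(\theta,x,\mathcal{A})$, $\bar P(\theta,(x,y),\mathcal{X}\times\mathcal{A})=P(\theta,y,\mathcal{A})$, and such that $\bar P(\theta,(x,x),\cdot)$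 is supported on the diagonal. For $x,z\in\mathcal{X}$, $\tau_{x,z}:=\inf\{t\ge0:X_t=Z_t\}$, where $(X_t,Z_t)_{t\ge0}$ starts at $(x,z)$ and evolves according to $\bar P(\theta_0)$. $\tau_{\pi(\theta_0),z}$ is the same coupling time when $X_0\sim\pi(\theta_0)$ and $Z_0=z$. Assumptions. (A1) There is a density $p(\theta,x,y)$ with $P(\theta,x,dy)=p(\theta,x,y)P(\theta_0,x,dy)$ for all $x,y\in\mathcal{X}$, $\theta\in\Theta$. There is $\epsilon>0$ such that $p(\cdot,x,y)$ is continuously differentiable on $[\theta_0-\epsilon,\theta_0+\epsilon]$ for each $x,y$; $p'(\theta,x,y)$ denotes the derivative in $\theta$, and $\omega_\epsilon(x,y):=\sup_{|\theta-\theta_0|<\epsilon}|p'(\theta,x,y)|$. There are a subset $A\subseteq\mathcal{X}$, an integer $n\ge1$, $\beta>0$ and a probability measure $\varphi$ with $P^n(\theta,x,dy)\ge\beta\varphi(dy)$ for $x\in A$, $y\in\mathcal{X}$, $|\theta-\theta_0|<\epsilon$. (A2) For a small set $K$ there are a measurable $V:\mathcal{X}\to[1,\infty)$ and constants $0<\lambda<1$, $b<\infty$ with $P(\theta)V(x)\le\lambda V(x)+b\,\mathbf{1}(x\in K)$, and the chains induced by $P(\theta)$ are irreducible and aperiodic, for $|\theta-\theta_0|<\epsilon$. Set $\bar V(x):=V(x)+\frac{b}{1-\lambda}$. Consequently there are constants $R<\infty$, $r<1$ such that for all $x\in\mathcal{X}$, $n\ge1$: $|\mathbb{E}^{\theta_0}_x[g(X_n)]-\pi(\theta_0)g|\le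 RV(x)r^n$ whenever $|g|\le V$, and $|\mathbb{E}^{\theta_0}_x[h(X_n)]-\pi(\theta_0)h|\le R\sqrt{V(x)}\,r^n$ whenever $|h|\le\sqrt V$. (A3) The starting distribution $\mu_0$ satisfies $\mu_0V<\infty$. (A4) $P(\tau_{x,z}>t)\le M(V(x)+V(z))\rho^t$ for all $x,z\in\mathcal{X}$ and $t\ge0$, for some constants $R<M<\infty$ and $r<\rho<1$. (A5) There exist $p>1$, $\kappa>1$, $\delta>0$ such that $|f^{2\kappa p+\delta}|_V<\infty$ and $|\Omega^{\frac{2\kappa p}{p-1}}|_V<\infty$, where for an exponent $a>0$, $f^a$ denotes the function $x\mapsto|f(x)|^a$ and $\Omega^a$ denotes the function $\Omega^a(x):=\int_{\mathcal{X}}\omega_\epsilon(x,y)^a\,P(\theta_0,x,dy)$. (The constant $p$ is unrelated to the density $p(\theta,x,y)$.) The function $U_{1,z}$. With $C_l:=\big[8(l-1)\max(1,2^{l-3})\big]^l$, $$U_{1,z}(L):=L\,A^1_z+L\left(\frac{\big(\rho^{\frac{\delta}{2p(2p+\delta)}}\big)^L}{1-\big(\rho^{\frac{\delta}{2p(2p+\delta)}}\big)^L}\right)^{2}B^1_z,$$ $$A^1_z:=4\,\big|f^{2p+\delta}\big|_V^{\frac{2}{2p+\delta}}\left(C_{\frac{2p}{p-1}}\big|\Omega^{\frac{2p}{p-1}}\big|_V\Big(1+\frac{b}{1-\lambda}\Big)\right)^{\frac{p-1}{p}}\left(1+\Big(\frac{b}{1-\lambda}\Big)^{\frac{2}{2p+\delta}}+\bar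 V(z)^{\frac{2}{2p+\delta}}\right),$$ $$B^1_z:=A^1_z\cdot M^{\frac{2\delta}{2p(2p+\delta)}}\left(1+\Big(\frac{b}{1-\lambda}\Big)^{\frac{2\delta}{2p(2p+\delta)}}+V(z)^{\frac{2\delta}{2p(2p+\delta)}}\right),$$ where the superscript $1$ in $A^1_z,B^1_z$ is an index. *)

(* Defs.v *)
From HB Require Import structures.
From mathcomp Require Import all_boot all_order all_algebra.
From mathcomp Require Import all_classical all_reals all_analysis.

Set Implicit Arguments.
Unset Strict Implicit.
Unset Printing Implicit Defensive.

Import Order.TTheory GRing.Theory Num.Theory.
Import numFieldNormedType.Exports.

Local Open Scope classical_set_scope.
Local Open Scope ring_scope.

(** * Markov kernels *)

(* [kpow K n x B] is K^n(x, B). *)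
Fixpoint kpow (R : realType) (d : measure_display) (T : measurableType d)
    (K : R.-pker T ~> T) (n : nat) (x : T) (B : set T) : \bar R :=
  if n is m.+1 then (\int[K x]_y kpow K m y B)%E else (\d_x B)%E.

Definition invariant_prob (R : realType) (d : measure_display)
    (T : measurableType d) (K : R.-pker T ~> T) (mu : probability T R) : Prop :=
  forall B, measurable B -> (\int[mu]_x K x B)%E = mu B.

Definition unique_invariant_prob (R : realType) (d : measure_display)
    (T : measurableType d) (K : R.-pker T ~> T) (mu : probability T R) : Prop :=
  invariant_prob K mu /\
  forall nu : probability T R, invariant_prob K nu ->
    forall B, measurable B -> nu B = mu B.

Definition small_set (R : realType) (d : measure_display)
    (T : measurableType d) (K : R.-pker T ~> T) (S : set T) : Prop :=
  measurable S /\
  exists (n : nat) (beta : R) (phi : probability T R),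
    [/\ (1 <= n)%N, 0 < beta &
        forall x B, S x -> measurable B ->
          (beta%:E * phi B <= kpow K n x B)%E].

(* phi-irreducibility in the sense of Meyn and Tweedie. *)
Definition irreducible_kernel (R : realType) (d : measure_display)
    (T : measurableType d) (K : R.-pker T ~> T) : Prop :=
  exists psi : {sigma_finite_measure set T -> \bar R},
    (0 < psi [set: T])%E /\
    forall B, measurable B -> (0 < psi B)%E ->
      forall x, exists2 n : nat, (1 <= n)%N & (0 < kpow K n x B)%E.

(* There is no cyclic decomposition D_0 -> D_1 -> ... -> D_(m-1) -> D_0 with
   m >= 2 charged by the invariant distribution mu. *)
Definition aperiodic_kernel (R : realType) (d : measure_display)
    (T : measurableType d) (K : R.-pker T ~> T) (mu : probability T R) : Prop :=
  ~ exists (m : nat) (D : nat -> set T),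
      [/\ (2 <= m)%N,
          forall i, (i < m)%N -> measurable (D i),
          trivIset `I_m D,
          forall i x, (i < m)%N -> D i x -> K x (D (i.+1 %% m)%N) = 1%E &
          (0 < mu (D 0%N))%E].

(** * Markov chains *)

(* sigma(Y_0, ..., Y_n) *)
Definition history (d d' : measure_display) (Om : measurableType d)
    (T : measurableType d') (Y : nat -> Om -> T) (n : nat) : set (set Om) :=
  <<s \bigcup_(i in `I_n.+1) preimage_set_system [set: Om] (Y i) measurable >>.

(* Under Pr, Y_0 has law mu and Pr(Y_(n+1) \in B | Y_0, ..., Y_n) = K(Y_n, B);
   the conditional probability is written out by its defining property. *)
Definition markov_chain (R : realType) (d d' : measure_display)
    (Om : measurableType d) (T : measurableType d') (Y : nat -> Om -> T)
    (K : R.-pker T ~> T) (mu : probability T R) (Pr : probability Om R) : Prop :=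
  [/\ forall n, measurable_fun [set: Om] (Y n),
      forall B, measurable B -> Pr (Y 0%N @^-1` B) = mu B &
      forall n E B, history Y n E -> measurable B ->
        Pr (E `&` Y n.+1 @^-1` B) = (\int[Pr]_(w in E) K (Y n w) B)%E].

(* Pr mu is the law under which Y starts from mu; Pr \d_x is the usual P_x. *)
Definition markov_family (R : realType) (d d' : measure_display)
    (Om : measurableType d) (T : measurableType d') (Y : nat -> Om -> T)
    (K : R.-pker T ~> T) (Pr : probability T R -> probability Om R) : Prop :=
  forall mu : probability T R, markov_chain Y K mu (Pr mu).

(** * Coupling *)

Definition coupling_kernel (R : realType) (d : measure_display)
    (T : measurableType d) (K : R.-pker T ~> T)
    (Kbar : R.-pker (T * T)%type ~> (T * T)%type) : Prop :=
  [/\ forall xy B, measurable B -> Kbar xy (B `*` [set: T]) = K xy.1 B,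
      forall xy B, measurable B -> Kbar xy ([set: T] `*` B) = K xy.2 B &
      forall x, Kbar (x, x) (~` diagonal) = 0%E].

(* inf {t >= 0 | X_t = Z_t}, equal to +oo when the set is empty. *)
Definition coupling_time (R : realType) (Om T : Type)
    (XZ : nat -> Om -> T * T) (w : Om) : \bar R :=
  ereal_inf [set t%:R%:E | t in [set t | (XZ t w).1 = (XZ t w).2]].

(** * The standing assumptions *)

(* Continuous differentiability on the closed interval [a, b]; the derivatives
   at the end points are one-sided. *)
Definition C1_on (R : realType) (a b : R) (g : R -> R) : Prop :=
  exists g' : R -> R,
    (forall t, t \in `[a, b] ->
       (fun s => (g s - g t) / (s - t)) @ within `[a, b] t^' --> g' t) /\
    {within `[a, b], continuous g'}.

Definition omega_ (R : realType) (T : Type) (p : R -> T -> T -> R)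
    (theta0 eps : R) (x y : T) : R :=
  sup [set `|derive1 (fun t => p t x y) theta| | theta in
         [set theta : R | `|theta - theta0| < eps]].

Definition Omega_pow (R : realType) (d : measure_display)
    (T : measurableType d) (K0 : R.-pker T ~> T) (p : R -> T -> T -> R)
    (theta0 eps a : R) (x : T) : \bar R :=
  (\int[K0 x]_y (omega_ p theta0 eps x y `^ a)%:E)%E.

Definition fpow (R : realType) (T : Type) (f : T -> R) (a : R) (x : T) : \bar R :=
  (`|f x| `^ a)%:E.

(* |h|_V = sup_x |h(x)| / V(x), possibly +oo. *)
Definition Vnorm (R : realType) (T : Type) (V : T -> R) (h : T -> \bar R) :
    \bar R :=
  ereal_sup (range (fun x => `|h x| * (V x)^-1%:E)%E).

(* P is only meaningful on Theta; C^1 regularity on the closed interval forces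
   the interval to lie in Theta. *)
Definition assumption_A1 (R : realType) (d : measure_display)
    (T : measurableType d) (Theta : set R) (theta0 : R)
    (P : R -> R.-pker T ~> T) (p : R -> T -> T -> R) (eps : R) : Prop :=
  [/\ forall theta x, Theta theta ->
        [/\ forall y, 0 <= p theta x y,
            measurable_fun [set: T] (p theta x) &
            forall B, measurable B ->
              P theta x B = (\int[P theta0 x]_(y in B) (p theta x y)%:E)%E],
      0 < eps,
      `[theta0 - eps, theta0 + eps] `<=` Theta,
      forall x y, C1_on (theta0 - eps) (theta0 + eps) (fun t => p t x y) &
      exists (A : set T) (n : nat) (beta : R) (phi : probability T R),
        [/\ (1 <= n)%N, 0 < beta &
            forall theta x B, `|theta - theta0| < eps -> A x -> measurable B ->
              (beta%:E * phi B <= kpow (P theta) n x B)%E]].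

(* The drift condition, irreducibility and aperiodicity; S is the small set. *)
Definition assumption_A2 (R : realType) (d : measure_display)
    (T : measurableType d) (theta0 : R) (P : R -> R.-pker T ~> T)
    (pi_ : R -> probability T R) (eps : R) (S : set T) (V : T -> R)
    (lam b : R) : Prop :=
  [/\ measurable_fun [set: T] V,
      forall x, 1 <= V x,
      0 < lam < 1 &
      forall theta, `|theta - theta0| < eps ->
        [/\ small_set (P theta) S,
            forall x, (\int[P theta x]_y (V y)%:E
                       <= (lam * V x + b * \1_S x)%:E)%E,
            irreducible_kernel (P theta) &
            aperiodic_kernel (P theta) (pi_ theta)]].

(* Geometric ergodicity of the chain (Y, Pr) towards mu, in the norms of V and
   of sqrt V, with common constants C and r. *)
Definition geometric_ergodicity (R : realType) (d d' : measure_display)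
    (Om : measurableType d') (T : measurableType d) (Y : nat -> Om -> T)
    (Pr : probability T R -> probability Om R) (mu : probability T R)
    (V : T -> R) (C r : R) : Prop :=
  r < 1 /\
  forall x n, (1 <= n)%N ->
    (forall g : T -> R, measurable_fun [set: T] g ->
       (forall y, `|g y| <= V y) ->
       (`| \int[Pr \d_x]_w (g (Y n w))%:E - \int[mu]_y (g y)%:E |
        <= (C * V x * r ^+ n)%:E)%E) /\
    (forall h : T -> R, measurable_fun [set: T] h ->
       (forall y, `|h y| <= Num.sqrt (V y)) ->
       (`| \int[Pr \d_x]_w (h (Y n w))%:E - \int[mu]_y (h y)%:E |
        <= (C * Num.sqrt (V x) * r ^+ n)%:E)%E).

Definition assumption_A4 (R : realType) (d d' : measure_display)
    (Om : measurableType d') (T : measurableType d)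
    (XZ : nat -> Om -> T * T)
    (Pr : probability (T * T)%type R -> probability Om R)
    (V : T -> R) (C r M rho : R) : Prop :=
  [/\ C < M, r < rho, rho < 1 &
      forall (x z : T) (t : nat),
        (Pr \d_(x, z) [set w | t%:R%:E < coupling_time R XZ w]
         <= (M * (V x + V z) * rho ^+ t)%:E)%E].

Definition assumption_A5 (R : realType) (d : measure_display)
    (T : measurableType d) (theta0 : R) (P : R -> R.-pker T ~> T)
    (p : R -> T -> T -> R) (eps : R) (V : T -> R) (f : T -> R)
    (q kappa delta : R) : Prop :=
  [/\ 1 < q, 1 < kappa, 0 < delta,
      (Vnorm V (fpow f (2 * kappa * q + delta)) < +oo)%E &
      (Vnorm V (Omega_pow (P theta0) p theta0 eps (2 * kappa * q / (q - 1)))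
       < +oo)%E].

(** * The bounds U_{1,z} and W *)

Definition Cconst (R : realType) (l : R) : R :=
  (8 * (l - 1) * Num.max 1 (2 `^ (l - 3))) `^ l.

(* In the four definitions below q is the exponent p > 1 of the moment
   assumption, and fnorm, Onorm stand for |f^(2q+delta)|_V and
   |Omega^(2q/(q-1))|_V; Vz is V(z), and Vz + b / (1 - lam) is Vbar(z). *)
Definition A1z (R : realType) (q delta lam b fnorm Onorm Vz : R) : R :=
  4 * fnorm `^ (2 / (2 * q + delta))
  * (Cconst (2 * q / (q - 1)) * Onorm * (1 + b / (1 - lam))) `^ ((q - 1) / q)
  * (1 + (b / (1 - lam)) `^ (2 / (2 * q + delta))
     + (Vz + b / (1 - lam)) `^ (2 / (2 * q + delta))).

Definition B1z (R : realType) (q delta lam b fnorm Onorm Vz M : R) : R :=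
  let e := 2 * delta / (2 * q * (2 * q + delta)) in
  A1z q delta lam b fnorm Onorm Vz
  * M `^ e * (1 + (b / (1 - lam)) `^ e + Vz `^ e).

Definition U1z (R : realType) (q delta lam b fnorm Onorm Vz M rho L : R) : R :=
  let c := rho `^ (delta / (2 * q * (2 * q + delta))) in
  L * A1z q delta lam b fnorm Onorm Vz
  + L * (c `^ L / (1 - c `^ L)) ^+ 2 * B1z q delta lam b fnorm Onorm Vz M.

(* Etau is E[tau_{pi(theta0), z}] and piV is pi(theta0) V. *)
Definition Wz (R : realType)
    (q delta lam b fnorm Onorm Vz M rho Etau piV L : R) : R :=
  (L + 2 * Etau) * U1z q delta lam b fnorm Onorm Vz M rho L * piV
  * (3 + 2 * M * rho `^ L / (1 - rho `^ L)).

(* Main.v *)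
Require Import Defs.
From HB Require Import structures.
From mathcomp Require Import all_boot all_order all_algebra.
From mathcomp Require Import all_classical all_reals all_analysis.
From mathcomp Require Import measurable_realfun ring lra zify.

Set Implicit Arguments.
Unset Strict Implicit.
Unset Printing Implicit Defensive.

Import Order.TTheory GRing.Theory Num.Theory.
Import numFieldNormedType.Exports.

Local Open Scope classical_set_scope.
Local Open Scope ring_scope.

(* Under P(tau > t) <= min(1, H rho^t) with H = M (pi V + V z), the inequality
   min(1, y) <= y^s turns the tail sum of E[tau] into
     D = E[tau] - 1 <= H^s g(1),  g(L) = c^L / (1 - c^L),  c = rho^s,
   with s the exponent occurring in U_1.  As pi V <= b / (1 - lambda) by the drift
   condition and y |-> y^(2 s) is subadditive, D^2 <= G g(1)^2 with G = B^1_z / A^1_z.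
   Moreover D g(D) <= g(1) by Bernoulli's inequality, so that
     D^2 (1 + G g(D)^2) <= 2 G g(1)^2 < 2 (1 + G g(1)^2),
   while the factor 3 + 2 M rho^L / (1 - rho^L) decreases in L. *)

(** * One-time laws of a Markov chain *)

(** On measurable sets [nu] is the composition of [K] with [mu], viewed as a constant kernel from
    [unit]; the integral formula for composed kernels then applies. *)
Lemma integral_law_step (R : realType) (d : measure_display)
    (T : measurableType d) (K : R.-pker T ~> T) (mu : probability T R)
    (nu : {measure set T -> \bar R}) (h : T -> \bar R) :
  (forall B, measurable B -> nu B = (\int[mu]_x K x B)%E) ->
  (forall x, 0 <= h x)%E -> measurable_fun [set: T] h ->
  (\int[nu]_x h x = \int[mu]_x \int[K x]_y h y)%E.
Proof.
move=> nuE h0 mh.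
have mcst : measurable_fun [set: unit] (cst (mu : pprobability T R)).
  exact: measurable_cst.
pose l := kprobability mcst.
have := @integral_kcomp _ _ _ _ _ _ R l (kernel.kernel_snd K) tt h h0 mh.
move=> <-; apply: eq_measure_integral => B mB _.
exact: nuE.
Qed.

Section markov_chain_laws.
Context (R : realType) (d d' : measure_display) (Om : measurableType d)
  (T : measurableType d') (Y : nat -> Om -> T) (K : R.-pker T ~> T).

Lemma history_last (n : nat) (B : set T) :
  measurable B -> history Y n (Y n @^-1` B).
Proof.
move=> mB; apply: sub_sigma_algebra; exists n => //=.
by exists B => //; rewrite setTI.
Qed.

Lemma history_setT (n : nat) : history Y n [set: Om].
Proof. by rewrite -(preimage_setT (Y n)); exact: history_last. Qed.

(** The Markov property with the whole space as conditioning event says that the law of [Y n.+1] is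
    the law of [Y n] followed by [K]; this passes from sets to nonnegative functions. *)
Lemma markov_chain_step (mu : probability T R) (Pr : probability Om R)
    (n : nat) (h : T -> \bar R) :
  markov_chain Y K mu Pr -> (forall x, 0 <= h x)%E ->
  measurable_fun [set: T] h ->
  (\int[Pr]_w h (Y n.+1 w) = \int[Pr]_w \int[K (Y n w)]_y h y)%E.
Proof.
move=> [mY _ YK] h0 mh.
have mKh : measurable_fun [set: T] (fun x => \int[K x]_y h y)%E.
  by apply: measurable_fun_integral_kernel => // U mU; exact: measurable_kernel.
pose rv k : {RV Pr >-> T} := HB.pack (Y k) (isMeasurableFun.Build _ _ _ _ _ (mY k)).
pose law k : probability T R := distribution Pr (rv k).
have lawE k g : (forall x, 0 <= g x)%E -> measurable_fun [set: T] g ->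
    (\int[Pr]_w g (Y k w) = \int[law k]_x g x)%E.
  by move=> g0 mg; rewrite ge0_integral_pushforward// preimage_setT.
rewrite (lawE _ h)// (lawE _ (fun x => \int[K x]_y h y)%E)//; last first.
  by move=> x; exact: integral_ge0.
apply: integral_law_step => // B mB.
rewrite -(lawE _ (K ^~ B))//; last exact: measurable_kernel.
have := YK n _ B (@history_setT n) mB.
by rewrite setTI.
Qed.

Lemma markov_chain0 (mu : probability T R) (Pr : probability Om R)
    (h : T -> \bar R) :
  markov_chain Y K mu Pr -> (forall x, 0 <= h x)%E ->
  measurable_fun [set: T] h ->
  (\int[Pr]_w h (Y 0%N w) = \int[mu]_x h x)%E.
Proof.
move=> [mY Y0 _] h0 mh.
rewrite -[LHS](ge0_integral_pushforward (mY 0%N) Pr (D := [set: T]))//.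
apply: eq_measure_integral => /= B mB _.
exact: Y0.
Qed.

(** Here [g] is the n-fold image of [h] under [K]. What matters is that it does not depend on the
    initial law. *)
Lemma markov_chain_expectation (n : nat) (h : T -> \bar R) :
  (forall x, 0 <= h x)%E -> measurable_fun [set: T] h ->
  exists g : T -> \bar R, [/\ forall x, (0 <= g x)%E, measurable_fun [set: T] g &
    forall (mu : probability T R) (Pr : probability Om R), markov_chain Y K mu Pr ->
      (\int[Pr]_w h (Y n w) = \int[mu]_x g x)%E].
Proof.
elim: n h => [|n IH] h h0 mh.
  by exists h; split => // mu Pr /markov_chain0; exact.
have [||g [g0 mg gE]] := IH (fun x => \int[K x]_y h y)%E.
- by move=> x; exact: integral_ge0.
- by apply: measurable_fun_integral_kernel => // U mU; exact: measurable_kernel.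
exists g; split => // mu Pr mc.
by rewrite (markov_chain_step n mc)// (gE mu).
Qed.

(** A [markov_family] carries no measurability in the starting point. It is recovered for events at
    one time: integrating the common [g] against a Dirac mass identifies the probability from x with
    [g x]. *)
Lemma markov_family_mixture (Pr : probability T R -> probability Om R)
    (n : nat) (B : set T) :
  markov_family Y K Pr -> measurable B ->
  measurable_fun [set: T] (fun x => Pr \d_x (Y n @^-1` B)) /\
  forall mu, Pr mu (Y n @^-1` B) = (\int[mu]_x Pr \d_x (Y n @^-1` B))%E.
Proof.
move=> mf mB.
have mI : measurable_fun [set: T] (fun x => (\1_B x)%:E : \bar R).
  by apply/measurable_EFinP; exact: measurable_indic.
have I0 x : (0 <= (\1_B x)%:E :> \bar R)%E by rewrite lee_fin.
have [g [g0 mg gE]] := markov_chain_expectation n I0 mI.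
have PrE mu : Pr mu (Y n @^-1` B) = (\int[mu]_x g x)%E.
  have [mY _ _] := mf mu.
  rewrite -(gE mu (Pr mu))//.
  rewrite -[in LHS](setIT (Y n @^-1` B)) -integral_indic//; last first.
    by rewrite -[_ @^-1` _]setTI; exact: mY.
have dE x : Pr \d_x (Y n @^-1` B) = g x.
  by rewrite PrE integral_dirac// diracT mul1e.
split; first by apply: eq_measurable_fun mg => x _; rewrite dE.
by move=> mu; rewrite PrE; apply: eq_integral => x _; rewrite dE.
Qed.

End markov_chain_laws.

(** * The coupling time: tail sums and uncoupled events *)

(** Pointwise tail-sum formula; [x] is a natural number, or infinite when [A] is empty. *)
Lemma ereal_series_gtE (R : realType) (A : set nat) (x : \bar R) :
  x = ereal_inf [set t%:R%:E | t in A] ->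
  x = (\sum_(t <oo) (t%:R%:E < x)%E%:R%:E)%E.
Proof.
move=> xE; set S := (X in _ = X).
have term_ge0 t : (0 <= (t%:R%:E < x)%E%:R%:E :> \bar R)%E.
  by rewrite lee_fin ler0n.
have S_ge0 : (0 <= S)%E by apply: nneseries_ge0 => t _ _; exact: term_ge0.
apply/eqP; rewrite eq_le; apply/andP; split.
  rewrite leNgt; apply/negP => Sx.
  (* If [S] were below [x], the first t terms would all be 1, so [S] would dominate every t,
     although it is finite. *)
  have ltx t : (t%:R%:E < x)%E /\ (t%:R%:E <= S)%E.
    elim/ltn_ind: t => t IH.
    have tS : (t%:R%:E <= S)%E.
      apply: (@le_trans _ _ (\sum_(0 <= i < t) (i%:R%:E < x)%E%:R%:E)%E); last first.
        by apply: nneseries_lim_ge => i _ _; exact: term_ge0.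
      rewrite (eq_big_nat _ _ (F2 := fun=> 1%E)); last first.
        by move=> i /andP[_ /IH[-> _]].
      by rewrite sumEFin sumr_const_nat subn0.
    by split => //; exact: le_lt_trans Sx.
  have Sfin : S \is a fin_num.
    by rewrite ge0_fin_numE// (lt_le_trans Sx)// leey.
  have := archi_boundP (fine_ge0 S_ge0).
  by rewrite ltNge -lee_fin fineK// (ltx _).2.
rewrite [leRHS]xE; apply: le_ereal_inf_tmp => _ [s As <-].
have xs : (x <= s%:R%:E)%E by rewrite xE; apply: ereal_inf_lbound; exists s.
apply: lime_le; first by apply: is_cvg_nneseries => t _ _; exact: term_ge0.
(* For [s] in [A], [x <= s], so a partial sum counts at most the t below both n and s. *)
apply: nearW => n; rewrite sumEFin lee_fin -natr_sum ler_nat.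
apply: (@leq_trans (\sum_(0 <= t < n) (t < s)%N)).
  apply: leq_sum => t _; have [ts|//] := boolP (t%:R%:E < x)%E.
  by have := lt_le_trans ts xs; rewrite lte_fin ltr_nat => ->.
rewrite (_ : \sum_(0 <= t < n) (t < s)%N = minn n s)%N ?geq_minr//.
elim: n => [|n IH]; first by rewrite big_nil min0n.
by rewrite big_nat_recr//= IH; lia.
Qed.

Section coupling_tail.
Context (R : realType) (d d' : measure_display) (Om : measurableType d')
  (T : measurableType d) (K : R.-pker T ~> T)
  (Kbar : R.-pker (T * T)%type ~> (T * T)%type) (XZ : nat -> Om -> T * T).
Hypotheses (hdiag : measurable (diagonal : set (T * T)))
  (hK : coupling_kernel K Kbar).

Lemma coupling_time_gtE (t : nat) :
  [set w | t%:R%:E < coupling_time R XZ w]%E =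
  \bigcap_(i in `I_t.+1) XZ i @^-1` (~` diagonal).
Proof.
apply/seteqP; split => w /=.
  move=> tw i /= it XZi; move: tw; rewrite ltNge => /negP; apply.
  apply: (@le_trans _ _ i%:R%:E); last by rewrite lee_fin ler_nat -ltnS.
  by apply: ereal_inf_lbound; exists i.
move=> tw; apply: (@lt_le_trans _ _ t.+1%:R%:E); first by rewrite lte_fin ltr_nat.
apply: le_ereal_inf_tmp => _ [s sw <-]; rewrite lee_fin ler_nat ltnNge.
by apply/negP => st; exact: (tw s).
Qed.

Let mXZ mu Pr (mc : markov_chain XZ Kbar mu Pr) n B :
  measurable B -> measurable (XZ n @^-1` B).
Proof. by move: mc => [mY _ _] mB; rewrite -[_ @^-1` _]setTI; exact: mY. Qed.

Lemma measurable_coupling_time_gt mu Pr (t : nat) :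
  markov_chain XZ Kbar mu Pr ->
  measurable [set w | t%:R%:E < coupling_time R XZ w]%E.
Proof.
move=> mc; rewrite coupling_time_gtE.
apply: bigcap_measurable => [|i _]; first by exists 0%N.
by apply: (mXZ mc); exact: measurableC.
Qed.

(* The diagonal is absorbing. *)
Lemma uncoupled_le mu Pr (t : nat) :
  markov_chain XZ Kbar mu Pr ->
  (Pr (XZ t @^-1` (~` diagonal)) <= Pr [set w | t%:R%:E < coupling_time R XZ w])%E.
Proof.
(* [Z s] is the event of leaving the diagonal between times s and s + 1. It is null, and off the
   union of these events being uncoupled at time t means being uncoupled at all earlier times. *)
move=> mc; pose Z s := XZ s @^-1` diagonal `&` XZ s.+1 @^-1` (~` diagonal).
have mZ s : measurable (Z s).
  by apply: measurableI; apply: (mXZ mc) => //; exact: measurableC.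
have mUZ : measurable (\bigcup_s Z s) by exact: bigcup_measurable.
have Z0 s : Pr (Z s) = 0%E.
  have [_ _ YK] := mc; have [_ _ Kdiag] := hK.
  rewrite YK; [|exact: history_last|exact: measurableC].
  apply: integral0_eq => w; rewrite /preimage/=; case: (XZ s w) => x y xy.
  have <- : x = y := xy.
  exact: Kdiag.
have UZ0 : Pr (\bigcup_s Z s) = 0%E.
  apply/(negligibleP Pr mUZ); apply: negligible_bigcup => s.
  by apply/(negligibleP Pr (mZ s)); exact: Z0.
rewrite -[leRHS]adde0 -UZ0.
have mgt := measurable_coupling_time_gt t mc.
apply: le_trans (measureU2 Pr mgt mUZ).
apply: le_measure; rewrite ?inE; [|exact: measurableU|].
  by apply: (mXZ mc); exact: measurableC.
move=> w wt; have [|nwt] := pselect ([set w | t%:R%:E < coupling_time R XZ w]%E w).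
  by left.
right; apply: contrapT => nZ; apply: nwt.
rewrite coupling_time_gtE => i /=; rewrite ltnS => it.
have {wt} : (~` diagonal) (XZ (i + (t - i))%N w) by rewrite subnKC.
(* Backward propagation from t to i: a coupled state at time i + k followed by an uncoupled one
   would lie in [Z (i + k)]. *)
elim: (t - i)%N => [|k IH]; first by rewrite addn0.
rewrite addnS => wS; apply: IH => wk; apply: nZ; exists (i + k)%N => //.
Qed.

End coupling_tail.

(** The mixture formula covers only events at one time. So the event that the coupling time exceeds
    t is enlarged to being uncoupled at t, mixed over the initial law, and compared back for each
    starting point by absorption. Tonelli reduces the product with the Dirac mass to an integral
    over [mu]. *)
Lemma coupling_tail_le (R : realType) (d d' : measure_display)
    (Om : measurableType d') (T : measurableType d) (K : R.-pker T ~> T)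
    (Kbar : R.-pker (T * T)%type ~> (T * T)%type) (XZ : nat -> Om -> T * T)
    (PrC : probability (T * T)%type R -> probability Om R)
    (mu : probability T R) (z : T) (t : nat) (g : T -> \bar R) :
  measurable (diagonal : set (T * T)) -> coupling_kernel K Kbar ->
  markov_family XZ Kbar PrC -> measurable_fun [set: T] g ->
  (forall x, PrC \d_(x, z) [set w | t%:R%:E < coupling_time R XZ w] <= g x)%E ->
  (PrC (mu \x \d_z)%E [set w | t%:R%:E < coupling_time R XZ w]
   <= \int[mu]_x g x)%E.
Proof.
move=> hdiag hK mf mg gle.
have mN := measurableC hdiag.
have [mF FE] := markov_family_mixture t mf mN.
set F := (fun xy => PrC \d_xy _) in mF FE.
apply: (@le_trans _ _ (PrC (mu \x \d_z)%E (XZ t @^-1` (~` diagonal)))).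
  apply: le_measure; rewrite ?inE.
  - by have := measurable_coupling_time_gt hdiag t (mf (mu \x \d_z)%E).
  - by have [mY _ _] := mf (mu \x \d_z)%E; rewrite -[X in measurable X]setTI; exact: mY.
  - by rewrite coupling_time_gtE => w /(_ t); apply => /=.
rewrite FE fubini_tonelli1//.
have fE x : fubini_F \d_z F x = F (x, z).
  rewrite /fubini_F integral_dirac ?diracT ?mul1e//.
  exact: measurableT_comp.
apply: ge0_le_integral => //.
- by move=> x _; rewrite fE.
- exact: measurable_fun_fubini_tonelli_F.
- move=> x _; rewrite fE; apply: le_trans (gle x).
  exact: (uncoupled_le hdiag hK _ (mf _)).
Qed.

Lemma expectation_coupling_time (R : realType) (d d' : measure_display)
    (Om : measurableType d') (T : measurableType d)
    (Kbar : R.-pker (T * T)%type ~> (T * T)%type) (XZ : nat -> Om -> T * T)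
    (mu : probability (T * T)%type R) (Pr : probability Om R) :
  measurable (diagonal : set (T * T)) -> markov_chain XZ Kbar mu Pr ->
  (\int[Pr]_w coupling_time R XZ w =
   \sum_(t <oo) Pr [set w | t%:R%:E < coupling_time R XZ w])%E.
Proof.
move=> hdiag mc.
have mgt t := measurable_coupling_time_gt hdiag t mc.
rewrite (eq_integral (fun w => \sum_(t <oo)
    (\1_[set w | t%:R%:E < coupling_time R XZ w]%E w)%:E)%E); last first.
  move=> w _; rewrite [LHS](ereal_series_gtE (erefl _)).
  apply: eq_eseriesr => t _; rewrite indicE; congr ((nat_of_bool _)%:R%:E).
  by apply/idP/idP; rewrite inE.
rewrite integral_nneseries//=.
- by apply: eq_eseriesr => t _; rewrite integral_indic// setIT.
- by move=> t; apply/measurable_EFinP; exact: measurable_indic.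
Qed.

(** * The stationary mean of V *)

(** Integrate the drift inequality against [mu]. Finiteness of the mean is what allows [lam] times
    it to be subtracted. *)
Lemma stationary_drift_bound (R : realType) (d : measure_display)
    (T : measurableType d) (K : R.-pker T ~> T) (mu : probability T R)
    (V : T -> R) (S : set T) (lam b : R) :
  invariant_prob K mu -> measurable_fun [set: T] V -> (forall x, 1 <= V x) ->
  0 < lam < 1 ->
  (forall x, \int[K x]_y (V y)%:E <= (lam * V x + b * \1_S x)%:E)%E ->
  (\int[mu]_x (V x)%:E < +oo)%E ->
  1 <= fine (\int[mu]_x (V x)%:E)%E <= b / (1 - lam).
Proof.
move=> inv mV V1 /andP[lam0 lam1] drift; set I := (\int[mu]_x _)%E => Ioo.
have V0 x : 0 <= V x by exact: le_trans (V1 x).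
have mVE : measurable_fun [set: T] (fun x => (V x)%:E) by exact/measurable_EFinP.
have I1 : (1 <= I)%E.
  have <- : (\int[mu]_x (cst 1 x) = 1)%E.
    by rewrite integral_cst//= probability_setT mul1e.

  by apply: ge0_le_integral => // x _; rewrite lee_fin.
have Ifin : I \is a fin_num by rewrite ge0_fin_numE// (le_trans _ I1).
(* The sign of [b] is not given; [b'] keeps every integrand nonnegative. At the end a negative [b]
   would give v <= lam v, contradicting v >= 1. *)
pose b' := Num.max b 0.
have b'0 : 0 <= b' by rewrite /b' le_max lexx orbT.
have Ile : (I <= lam%:E * I + b'%:E)%E.
  rewrite /I [leLHS](integral_law_step (K := K) (mu := mu))//; last first.
    by move=> B mB; rewrite inv.
  apply: (@le_trans _ _ (\int[mu]_x (lam%:E * (V x)%:E + b'%:E))%E).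
    apply: ge0_le_integral => //.
    - by move=> x _; apply: integral_ge0 => y _; rewrite lee_fin.
    - apply: measurable_fun_integral_kernel => // U mU; exact: measurable_kernel.
    - by apply: emeasurable_funD => //; exact: measurable_funeM.
    - move=> x _; apply: le_trans (drift x) _.
      rewrite -EFinM -EFinD lee_fin lerD2l indicE; case: (x \in S).
        by rewrite mulr1 /b' le_max lexx.
      by rewrite mulr0.
  rewrite ge0_integralD//; last 2 first.
  - by move=> x _; rewrite -EFinM lee_fin mulr_ge0// ltW.
  - exact: measurable_funeM.
  rewrite ge0_integralZl//; last 2 first.
  - by move=> x _; rewrite lee_fin.
  - exact: ltW.
  by rewrite integral_cst//= probability_setT mule1.
move: I1 Ile; rewrite -(fineK Ifin) -EFinM -EFinD !lee_fin.
move: (fine I) => v I1 Ile; rewrite I1/= ler_pdivlMr ?subr_gt0//.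
have [b0|b0] := leP 0 b.
  by move: Ile; rewrite /b' max_l// => Ile; lra.
by move: Ile; rewrite /b' max_r ?(ltW b0)// => Ile; nra.
Qed.

(** Ergodicity at time 1 with g = V bounds the distance between a finite one-step mean and the
    stationary mean, which therefore cannot be infinite. *)
Lemma ergodic_integral_lty (R : realType) (d d' : measure_display)
    (Om : measurableType d') (T : measurableType d) (Y : nat -> Om -> T)
    (K : R.-pker T ~> T) (Pr : probability T R -> probability Om R)
    (mu : probability T R) (V : T -> R) (C r c : R) (z : T) :
  markov_family Y K Pr -> geometric_ergodicity Y Pr mu V C r ->
  measurable_fun [set: T] V -> (forall x, 0 <= V x) ->
  (\int[K z]_y (V y)%:E <= c%:E)%E ->
  (\int[mu]_x (V x)%:E < +oo)%E.
Proof.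
move=> mf [_ /(_ z 1%N (leqnn _))[/(_ V) ge _]] mV V0 Kc.
have mVE : measurable_fun [set: T] (fun x => (V x)%:E) by exact/measurable_EFinP.
have V0E x : (0 <= (V x)%:E)%E by rewrite lee_fin.
have Y1E : (\int[Pr \d_z]_w (V (Y 1%N w))%:E = \int[K z]_y (V y)%:E)%E.
  rewrite (markov_chain_step 0 (mf \d_z) V0E mVE).
  rewrite (markov_chain0 (h := fun x => \int[K x]_y (V y)%:E)%E (mf \d_z)).
  - rewrite integral_dirac ?diracT ?mul1e//.
    apply: measurable_fun_integral_kernel => // U mU; exact: measurable_kernel.
  - by move=> x; exact: integral_ge0.
  - apply: measurable_fun_integral_kernel => // U mU; exact: measurable_kernel.
have {ge} : (`| \int[K z]_y (V y)%:E - \int[mu]_y (V y)%:E | < +oo)%E.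
  rewrite -Y1E; apply: (le_lt_trans (ge mV _)); last by rewrite ltry.
  by move=> y; rewrite ger0_norm.
have K0 : (0 <= \int[K z]_y (V y)%:E)%E by exact: integral_ge0.
have Kfin : (\int[K z]_y (V y)%:E)%E \is a fin_num.
  by rewrite ge0_fin_numE// (le_lt_trans Kc)// ltry.
rewrite -(fineK Kfin).
case: (\int[mu]_x (V x)%:E)%E => [s|//|//] _.
by rewrite ltry.
Qed.

(** * Inequalities for real powers and geometric tails *)

Lemma powR_lt1 (R : realType) (a x : R) : 0 < x < 1 -> 0 < a -> x `^ a < 1.
Proof.
move=> /andP[x0 x1] a0; have := @gt0_ltr_powR R a a0 x 1.
by rewrite powR1 !nnegrE (ltW x0) ler01; exact.
Qed.

(** For a fraction u in (0, 1] one has u <= u^e; apply this to x / (x + y) and y / (x + y) and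
    add. *)
Lemma powR_subadditive (R : realType) (e x y : R) :
  0 < e <= 1 -> 0 < x -> 0 < y -> (x + y) `^ e <= x `^ e + y `^ e.
Proof.
move=> /andP[e0 e1] x0 y0; have xy0 : 0 < x + y by exact: addr_gt0.
have frac t : 0 < t -> t <= x + y -> t / (x + y) * (x + y) `^ e <= t `^ e.
  move=> t0 txy; have tE : t = t / (x + y) * (x + y) by rewrite divfK ?gt_eqF.
  have t1 : 0 < t / (x + y) <= 1 by rewrite divr_gt0//= ler_pdivrMr// mul1r.
  have t1' : 0 <= t / (x + y) by have /andP[/ltW] := t1.
  rewrite [in leRHS]tE powRM ?(ltW xy0)// ler_wpM2r ?powR_ge0//.
  exact: ger1_powR.
have := lerD (frac x x0 _) (frac y y0 _).
by rewrite -mulrDl -mulrDl divff ?gt_eqF// mul1r lerDl lerDr => -> //; exact: ltW.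
Qed.

(* Bernoulli's inequality [D (c^-1 - 1) <= c^-D - 1], as a case of Young's. *)
Lemma powR_geometric_antitone (R : realType) (c D : R) :
  0 < c < 1 -> 1 <= D -> D * (c `^ D / (1 - c `^ D)) <= c / (1 - c).
Proof.
move=> /andP[c0 c1] D1; have D0 : 0 < D by exact: lt_le_trans D1.
have c0' := ltW c0; have D0' := ltW D0.
set k := c `^ D; have k0 : 0 < k by exact: powR_gt0.
have k0' := ltW k0.
have k1 : k < 1 by rewrite powR_lt1 ?c0.
have young : D / c <= k^-1 + D - 1.
  (* The conjugate exponent D / (D - 1) is infinite at D = 1, where the claim is an equality.
     Otherwise Young's inequality is applied to 1 / c and 1. *)
  have [De|Dn1] := eqVneq D 1; first by rewrite /k De powRr1// mul1r addrK.
  have {Dn1}D1' : 1 < D by rewrite lt_neqAle eq_sym Dn1.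
  have Dm : 0 < D - 1 by rewrite subr_gt0.
  have D1n : D - 1 != 0 by rewrite gt_eqF.
  have Dn : D != 0 by rewrite gt_eqF.
  have qE : (D / (D - 1))^-1 = 1 - D^-1 by field; rewrite D1n Dn.
  have kE : c^-1 `^ D = k^-1 by rewrite -powR_inv1// powRAC powR_inv1.
  have := @conjugate_powR R c^-1 1 D (D / (D - 1)).
  rewrite mulr1 powR1 mul1r qE kE subrKC invr_ge0.
  move=> /(_ c0' ler01 D0 (divr_gt0 D0 Dm) erefl).
  rewrite -(ler_pM2l D0) => /le_trans -> //.
  rewrite (_ : D * _ = k^-1 + D - 1)//; field; rewrite Dn gt_eqF//.
rewrite mulrA ler_pdivrMr ?subr_gt0// mulrAC ler_pdivlMr ?subr_gt0//.
(* Multiplication by c k clears the denominators and leaves D k <= c + (D - 1) c k, a rearrangement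
   of the goal. *)
have : D / c * (c * k) <= (k^-1 + D - 1) * (c * k).
  by rewrite ler_wpM2r ?mulr_ge0.
rewrite mulrA divfK ?gt_eqF// [leRHS](_ : _ = c + (D - 1) * c * k); first nra.
by field; rewrite gt_eqF.
Qed.

(* [min 1 y <= y ^ s] trades the crossover of the two bounds on [u t] for a
   geometric tail. *)
Lemma series_interpolation_le (R : realType) (u : nat -> \bar R) (H rho s : R) :
  0 <= H -> 0 < rho < 1 -> 0 < s <= 1 ->
  (forall t, 0 <= u t <= 1)%E -> (forall t, u t <= (H * rho ^+ t)%:E)%E ->
  (\sum_(t <oo) u t <= (1 + H `^ s * (rho `^ s / (1 - rho `^ s)))%:E)%E.
Proof.
move=> H0 /andP[rho0 rho1] /andP[s0 s1] u01 uH; set c := rho `^ s.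
have c0 : 0 < c by exact: powR_gt0.
have rho0' := ltW rho0; have c0' := ltW c0.
have c1 : c < 1 by rewrite powR_lt1 ?rho0.
have us t : (u t <= (H `^ s * c ^+ t)%:E)%E.
  have -> : H `^ s * c ^+ t = (H * rho ^+ t) `^ s.
    rewrite (powRM _ H0 (exprn_ge0 _ rho0')) -(powR_mulrn t rho0').
    by rewrite -(powR_mulrn t c0') powRAC.
  have y0 : 0 <= H * rho ^+ t by rewrite mulr_ge0// exprn_ge0// ltW.
  have [y1|y1] := leP (H * rho ^+ t) 1.
    apply: le_trans (uH t) _; rewrite lee_fin.
    move: y0; rewrite le_eqVlt => /predU1P[<-|y0]; first exact: powR_ge0.
    by rewrite ger1_powR// y0 y1.
  have /andP[_ ut1] := u01 t; apply: le_trans ut1 _.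
  by rewrite lee_fin -(powRr0 (H * rho ^+ t)) ler_powR// ltW.
have u0 t : (0 <= u t)%E by have /andP[] := u01 t.
apply: lime_le; first by apply: is_cvg_nneseries.
apply: nearW => -[|n].
  rewrite big_nil lee_fin addr_ge0// mulr_ge0 ?powR_ge0// divr_ge0//.
  by rewrite subr_ge0 ltW.
(* The term t = 0 is bounded by 1 instead of [H ^ s], so the geometric sum starts at c. This is why
   the bound concerns E[tau] - 1. *)
apply: (@le_trans _ _ (1 + H `^ s * (c * (1 - c ^+ n) / (1 - c)))%:E).
  elim: n => [|n IH].
    by rewrite big_nat1 expr0 subrr mulr0 mul0r mulr0 addr0; have /andP[] := u01 0%N.
  rewrite big_nat_recr//=; apply: le_trans (leeD IH (us _)) _.
  rewrite -EFinD lee_fin -addrA lerD2l -mulrDr exprS ler_wpM2l ?powR_ge0//.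
  have c1' : 1 - c != 0 by rewrite subr_eq0 gt_eqF.
  by rewrite le_eqVlt; apply/orP; left; apply/eqP; field.
rewrite lee_fin lerD2l ler_wpM2l ?powR_ge0// ler_wpM2r//.
  by rewrite invr_ge0 subr_ge0 ltW.
by rewrite ler_piMr// gerBl exprn_ge0.
Qed.

(** * The comparison of W(1) with W(D) *)

(** The purely real part of the argument: probability enters only through the bounds on [piV] and on
    [E - 1]. *)
Lemma Wz_ratio_gt (R : realType) (q delta lam b fnorm Onorm Vz M rho E piV : R) :
  let W := Wz q delta lam b fnorm Onorm Vz M rho E piV in
  let s := delta / (2 * q * (2 * q + delta)) in
  1 < q -> 0 < delta -> 0 < M -> 0 < rho < 1 -> 0 < Vz ->
  1 <= piV <= b / (1 - lam) -> 1 <= E - 1 ->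
  E - 1 <= (M * (piV + Vz)) `^ s * (rho `^ s / (1 - rho `^ s)) ->
  W (E - 1) <> 0 -> (E - 1) / 3 < W 1 / W (E - 1).
Proof.
move=> W s q1 delta0 M0 rho01 Vz0 /andP[piV1 piVb] D1 Dle WD.
set D := E - 1 in D1 Dle WD *.
have D0 : 0 < D by exact: lt_le_trans D1.
have EE : E = D + 1 by rewrite /D subrK.
have /andP[rho0 rho1] := rho01; have piV0 : 0 < piV by exact: lt_le_trans piV1.
have D0' := ltW D0; have rho0' := ltW rho0; have piV0' := ltW piV0.
have M0' := ltW M0; have Vz0' := ltW Vz0.
have den0 : 0 < 2 * q * (2 * q + delta) by nra.
have s0 : 0 < s by exact: divr_gt0.
set e := 2 * delta / (2 * q * (2 * q + delta)).
have eE : e = s * 2 by rewrite /e /s -mulrA mulrC.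
have e0 : 0 < e by rewrite eE mulr_gt0.
have e1 : e <= 1 by rewrite /e ler_pdivrMr// mul1r; nra.
set c := rho `^ s in Dle.
have c0 : 0 < c by exact: powR_gt0.
have c0' := ltW c0; have e0' := ltW e0.
have c1 : c < 1 by exact: powR_lt1.
pose g L := c `^ L / (1 - c `^ L).
pose G := M `^ e * (1 + (b / (1 - lam)) `^ e + Vz `^ e).
pose h L := 3 + 2 * M * rho `^ L / (1 - rho `^ L).
set A := A1z q delta lam b fnorm Onorm Vz.
have WE L : W L = (L + 2 * E) * (L * (A * (1 + G * g L ^+ 2))) * piV * h L.
  by rewrite /W /Wz /U1z /B1z -/A -/e -/s -/c -/(g L) /G /h; ring.
have A0 : 0 <= A.
  have beta0 : 0 <= b / (1 - lam) by lra.
  by rewrite /A /A1z !mulr_ge0 ?powR_ge0// !addr_ge0 ?powR_ge0.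
rewrite !WE in WD *.
clearbody A D.
(* [A] vanishes when [fnorm] or [Onorm] does; then W(D) = 0 and the quotient takes the default value
   0. The hypothesis on W(D) excludes this. *)
have {}A0 : 0 < A.
  by rewrite lt_neqAle A0 andbT; apply/eqP => AE; apply: WD; rewrite -AE; ring.
have G0 : 0 < G.
  by rewrite mulr_gt0 ?powR_gt0// addr_gt0 ?powR_gt0// ltr_wpDr ?powR_ge0.
have G0' := ltW G0.
have g1 : g 1 = c / (1 - c) by rewrite /g powRr1// ltW.
have Dg : D * g D <= g 1 by rewrite g1; apply: powR_geometric_antitone; rewrite ?c0.
have rhoD : D * (rho `^ D / (1 - rho `^ D)) <= rho / (1 - rho).
  exact: powR_geometric_antitone.
have pow_lt1 x : 0 < x < 1 -> 0 < x `^ D < 1.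
  by move=> x01; rewrite powR_lt1// powR_gt0//; have /andP[] := x01.
have gD0 : 0 < g D.
  have /andP[k0 k1] : 0 < c `^ D < 1 by rewrite pow_lt1// c0.
  by rewrite divr_gt0// subr_gt0.
have /andP[rD0 rD1] := pow_lt1 rho rho01.
have kD0 : 0 < rho `^ D / (1 - rho `^ D) by rewrite divr_gt0// subr_gt0.
have hD0 : 0 < h D.
  by rewrite /h -mulrA ltr_wpDr// mulr_ge0// ?(ltW kD0)// mulr_ge0.
have hD1 : h D <= h 1.
  rewrite /h powRr1// lerD2l -!mulrA ler_pM2l// ler_pM2l//.
  by apply: le_trans rhoD; rewrite ler_peMl// (ltW kD0).
(* Squaring the bound on D turns the exponent s into e = 2 s. Subadditivity splits (piV + Vz)^e, and
   the summand 1 in [G] is slack. *)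
have DG : D ^+ 2 <= G * g 1 ^+ 2.
  have gE0 : 0 <= g 1 by apply: le_trans Dg; rewrite mulr_ge0// (ltW gD0).
  apply: (@le_trans _ _ (((M * (piV + Vz)) `^ s * g 1) ^+ 2)).
    by apply: lerXn2r; rewrite ?nnegrE// ?g1// -g1 mulr_ge0 ?powR_ge0.
  rewrite exprMn ler_wpM2r ?sqr_ge0// -powR_mulrn ?powR_ge0// -powRrM -eE.
  rewrite powRM ?addr_ge0// ler_wpM2l ?powR_ge0//.
  apply: le_trans (powR_subadditive _ piV0 Vz0) _; first by rewrite e0.
  rewrite lerD2r ler_wpDl// ge0_ler_powR ?nnegrE//.
  exact: le_trans piVb.
have DgD : G * (D * g D) ^+ 2 <= G * g 1 ^+ 2.
  have DgD0 : 0 <= D * g D by rewrite mulr_ge0// (ltW gD0).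
  by rewrite ler_pM2l//; apply: lerXn2r; rewrite ?nnegrE//; exact: le_trans Dg.
have uD0 : 0 < 1 + G * g D ^+ 2 by rewrite ltr_wpDr// mulr_ge0 ?sqr_ge0.
rewrite ltr_pdivlMr; last by rewrite !mulr_gt0//; lra.
(* Both sides are split into matching factors. As E = D + 1, (D + 2 E) / 3 = D + 2/3 is less than (1
   + 2 E) / 2 = D + 3/2; the factor 2 so released absorbs the sum of [DG] and [DgD]. *)
have -> : D / 3 * ((D + 2 * E) * (D * (A * (1 + G * g D ^+ 2))) * piV * h D) =
    (A * piV) * ((D + 2 * E) / 3 * (D ^+ 2 + G * (D * g D) ^+ 2) * h D) by field.
have -> : (1 + 2 * E) * (1 * (A * (1 + G * g 1 ^+ 2))) * piV * h 1 =
    (A * piV) * ((1 + 2 * E) / 2 * (2 * (1 + G * g 1 ^+ 2)) * h 1) by field.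
have a0 := le_trans (sqr_ge0 D) DG.
have E1 : 0 <= (1 + 2 * E) / 2 * (2 * (1 + G * g 1 ^+ 2)).
  by apply: mulr_ge0; lra.
rewrite ltr_pM2l ?mulr_gt0//; apply: lt_le_trans (ler_wpM2l E1 hD1).
rewrite ltr_pM2r//; apply: ltr_pM; [lra| |lra|lra].
by rewrite addr_ge0 ?sqr_ge0// mulr_ge0 ?sqr_ge0.
Qed.

(** * From the assumptions on the chain to the real inequality *)

Theorem theorem4p1 (R : realType) (d : measure_display) (X : measurableType d)
  (* the family of kernels, its invariant distributions, and f *)
  (Theta : set R) (theta0 : R) (P : R -> R.-pker X ~> X)
  (pi_ : R -> probability X R) (f : X -> R)
  (* the chain with kernel P(theta0), realized on OmY for every initial law *)
  (dY : measure_display) (OmY : measurableType dY) (Y : nat -> OmY -> X)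
  (PrY : probability X R -> probability OmY R)
  (* the coupled chain with kernel Pbar(theta0), likewise *)
  (Pbar : R -> R.-pker (X * X)%type ~> (X * X)%type)
  (dC : measure_display) (OmC : measurableType dC) (XZ : nat -> OmC -> X * X)
  (PrC : probability (X * X)%type R -> probability OmC R)
  (* density, drift, coupling and moment constants *)
  (p : R -> X -> X -> R) (eps : R)
  (K : set X) (V : X -> R) (lam b C r : R) (mu0 : probability X R)
  (M rho q kappa delta : R) (z : X)
  (htheta0 : Theta theta0)
  (hpi : forall theta, Theta theta -> unique_invariant_prob (P theta) (pi_ theta))
  (hf : forall theta, Theta theta ->
     (pi_ theta).-integrable [set: X] (fun x => (f x)%:E))
  (hY : markov_family Y (P theta0) PrY)
  (hdiag : measurable (diagonal : set (X * X)))
  (hPbar : forall theta, Theta theta -> coupling_kernel (P theta) (Pbar theta))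
  (hXZ : markov_family XZ (Pbar theta0) PrC)
  (hA1 : assumption_A1 Theta theta0 P p eps)
  (hA2 : assumption_A2 theta0 P pi_ eps K V lam b)
  (hA2' : geometric_ergodicity Y PrY (pi_ theta0) V C r)
  (hA3 : (\int[mu0]_x (V x)%:E < +oo)%E)
  (hA4 : assumption_A4 XZ PrC V C r M rho)
  (hA5 : assumption_A5 theta0 P p eps V f q kappa delta) :
  let Etau : \bar R :=
    (\int[PrC (pi_ theta0 \x \d_z)%E]_w coupling_time R XZ w)%E in
  let D : R := fine Etau - 1 in
  let W : R -> R :=
    Wz q delta lam b
      (fine (Vnorm V (fpow f (2 * q + delta))))
      (fine (Vnorm V (Omega_pow (P theta0) p theta0 eps (2 * q / (q - 1)))))
      (V z) M rho (fine Etau) (fine (\int[pi_ theta0]_x (V x)%:E)%E) in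
  (1 <= Etau - 1)%E ->
  (* the quotient W(1) / W(D) is meaningful *)
  W D <> 0 ->
  D / 3 < W 1 / W D.
Proof.
move=> Etau D W D1 WD.
have [_ eps0 _ _ _] := hA1.
have [mV V1 lam01 /(_ theta0)] := hA2.
rewrite subrr normr0 => /(_ eps0)[_ drift _ _].
have [q1 kappa1 delta0 _ _] := hA5; have [_ _ rho1 tail] := hA4.
have V0 x : 0 <= V x by exact: le_trans (V1 x).
have Vz0 : 0 < V z by exact: lt_le_trans (V1 z).
(* Finiteness of the stationary mean makes [fine] faithful in W and is required for the drift
   bound. *)
have piVoo := ergodic_integral_lty hY hA2' mV V0 (drift z).
have /andP[piV1 piVb] := stationary_drift_bound (hpi theta0 htheta0).1 mV V1
  lam01 drift piVoo.
set piV := fine _ in piV1 piVb W WD *.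
have piVE : (\int[pi_ theta0]_x (V x)%:E = piV%:E)%E.
  by rewrite fineK// ge0_fin_numE//; apply: integral_ge0 => x _; rewrite lee_fin.
pose u t := PrC (pi_ theta0 \x \d_z)%E [set w | t%:R%:E < coupling_time R XZ w]%E.
have EtauE : Etau = (\sum_(t <oo) u t)%E.
  exact: (expectation_coupling_time hdiag (hXZ (pi_ theta0 \x \d_z)%E)).
have u01 t : (0 <= u t <= 1)%E.
  rewrite measure_ge0 probability_le1//.
  by have := measurable_coupling_time_gt hdiag t (hXZ (pi_ theta0 \x \d_z)%E).
have tail_le t : (u t <= \int[pi_ theta0]_x (M * (V x + V z) * rho ^+ t)%:E)%E.
  apply: (coupling_tail_le _ hdiag (hPbar theta0 htheta0) hXZ) => [|x]; last exact: tail.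
  by apply/measurable_EFinP; do 2!apply: measurable_funM => //; exact: measurable_funD.
(* (A4) states no sign for M or rho. Since probabilities are nonnegative, its instances at t = 0 and
   t = 1 give M >= 0 and M rho >= 0. *)
have M0 : 0 <= M.
  have := le_trans (measure_ge0 _ _) (tail z z 0%N).
  by rewrite lee_fin expr0 mulr1 pmulr_lge0// addr_gt0.
have Mrho0 : 0 <= M * rho.
  have := le_trans (measure_ge0 _ _) (tail z z 1%N).
  by rewrite lee_fin expr1 mulrAC pmulr_lge0// addr_gt0.
(* Otherwise tau <= 1 almost surely, hence E[tau] <= 1. *)
have {Mrho0}Mrho0 : 0 < M * rho.
  rewrite lt_neqAle Mrho0 andbT; apply/eqP => Mrho.
  move: D1; rewrite EtauE nneseries_recl//.
  rewrite eseries0 => [|t t0 _]; last first.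
    apply/eqP; rewrite eq_le (andP (u01 t)).1 andbT.
    apply: le_trans (tail_le t) _; rewrite integral0_eq// => x _.
    by rewrite -(prednK t0) exprS mulrACA -Mrho mul0r.
  rewrite adde0; apply/negP; rewrite -ltNge.
  have /andP[_ u0] := u01 0%N.
  by apply: (@le_lt_trans _ _ 0%E); rewrite ?lte01// leeBlDr// add0e.
have {}M0 : 0 < M.
  by rewrite lt_neqAle M0 andbT; apply/eqP => Me; rewrite -Me mul0r ltxx in Mrho0.
have rho0 : 0 < rho by rewrite pmulr_rgt0 in Mrho0.
pose H := M * (piV + V z).
have uH t : (u t <= (H * rho ^+ t)%:E)%E.
  apply: le_trans (tail_le t) _.
  rewrite (eq_integral (fun x => (M * rho ^+ t)%:E * ((V x)%:E + (V z)%:E))%E).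
    have mVE : measurable_fun [set: X] (fun x => (V x)%:E) by exact/measurable_EFinP.
    have VE0 x : (0 <= (V x)%:E)%E by rewrite lee_fin.
    rewrite ge0_integralZl//; last 3 first.
    - exact: emeasurable_funD.
    - by move=> x _; exact: adde_ge0.
    - by rewrite lee_fin mulr_ge0 ?exprn_ge0// ltW.
    rewrite ge0_integralD// piVE integral_cst//= probability_setT mule1.
    by rewrite -EFinD -EFinM mulrAC.
  by move=> x _; rewrite -EFinD -EFinM mulrAC.
pose s := delta / (2 * q * (2 * q + delta)).
have s01 : 0 < s <= 1.
  have den0 : 0 < 2 * q * (2 * q + delta) by nra.
  by rewrite divr_gt0//= ler_pdivrMr// mul1r; nra.
have H0 : 0 <= H by rewrite mulr_ge0 ?addr_ge0// ltW// (lt_le_trans _ piV1).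
have := series_interpolation_le H0 (introT andP (conj rho0 rho1)) s01 u01 uH.
rewrite -EtauE => Etau_le.
(* The interpolated bound also shows that E[tau] is finite, so [D] is the true E[tau] - 1. *)
have EtauK : (fine Etau)%:E = Etau.
  rewrite fineK// ge0_fin_numE; first by apply: le_lt_trans Etau_le _; rewrite ltry.
  by rewrite EtauE; apply: nneseries_ge0 => t _ _; have /andP[] := u01 t.
apply: Wz_ratio_gt => //.
- by rewrite rho0.
- by rewrite piV1.
- by rewrite -lee_fin EFinB EtauK.
- by rewrite lerBlDl -lee_fin EtauK.
Qed.
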